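(* The group \[G=\langle a,b,t \mid tat^{-1}=ab,\ tbt^{-1}=b\rangle\] cannot act properly, preserving factors, on any finite product $T_1\times\cdots\times T_k$ of locally finite trees.
   Context: Trees are simplicial trees; locally finite means every vertex has finite degree. A group $G$ acts on a product of trees $P=T_1\times\cdots\times T_k$ preserving factors if the action is given by a homomorphism $G\to\mathrm{Aut}(T_1)\times\cdots\times\mathrm{Aut}(T_k)$. The action is proper if the stabiliser of every vertex of $P$ is finite. *)

(* Defs.v *)
From HB Require Import structures.
From mathcomp Require Import all_boot.
From mathcomp Require Import boolp classical_sets cardinality.

Set Implicit Arguments.
Unset Strict Implicit.
Unset Printing Implicit Defensive.

Local Open Scope classical_set_scope.
Local Open Scope quotient_scope.
Local Open Scope group_scope.

(* The letter (x, true) stands for x and (x, false) for its formal inverse.   *)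
Notation word X := (seq (X * bool)).

Definition pos (X : choiceType) (x : X) : X * bool := (x, true).
Definition neg (X : choiceType) (x : X) : X * bool := (x, false).

(* The smallest congruence on words that cancels inverse letters and          *)
(* identifies u with v for every relation (u, v) in rels.                     *)
Inductive pres_eq (X : choiceType) (rels : seq (word X * word X))
    : word X -> word X -> Prop :=
| pres_refl u : pres_eq rels u u
| pres_sym u v : pres_eq rels u v -> pres_eq rels v u
| pres_trans u v w : pres_eq rels u v -> pres_eq rels v w -> pres_eq rels u w
| pres_cat u u' v v' :
    pres_eq rels u u' -> pres_eq rels v v' -> pres_eq rels (u ++ v) (u' ++ v')
| pres_cancel (x : X) (b : bool) : pres_eq rels [:: (x, b); (x, ~~ b)] [::]
| pres_rel u v : (u, v) \in rels -> pres_eq rels u v.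

Section Presentation.
Variables (X : choiceType) (rels : seq (word X * word X)).
Implicit Types u v w : word X.

Definition pres_rel_bool u v : bool := `[< pres_eq rels u v >].

Lemma pres_rel_bool_refl : reflexive pres_rel_bool.
Proof. by move=> u; apply/asboolP; exact: pres_refl. Qed.

Lemma pres_rel_bool_sym : symmetric pres_rel_bool.
Proof. by move=> u v; apply/asboolP/asboolP; exact: pres_sym. Qed.

Lemma pres_rel_bool_trans : transitive pres_rel_bool.
Proof.
move=> v u w /asboolP uv /asboolP vw; apply/asboolP; exact: pres_trans uv vw.
Qed.

Canonical pres_equiv :=
  EquivRel pres_rel_bool pres_rel_bool_refl pres_rel_bool_sym
    pres_rel_bool_trans.

Definition presented_group := {eq_quot pres_equiv}.
HB.instance Definition _ := Choice.on presented_group.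
HB.instance Definition _ := EqQuotient.on presented_group.

Definition pres_class u : presented_group := \pi_presented_group u.

Lemma pres_classP u v : pres_class u = pres_class v <-> pres_eq rels u v.
Proof.
split=> [/eqmodP/asboolP //|uv]; apply/eqmodP; exact/asboolP.
Qed.

Definition word_inv u := rev [seq (l.1, ~~ l.2) | l <- u].

Definition pres_one : presented_group := pres_class [::].
Definition pres_mul (g h : presented_group) : presented_group :=
  pres_class (repr g ++ repr h).
Definition pres_inv (g : presented_group) : presented_group :=
  pres_class (word_inv (repr g)).

Lemma pres_class_repr g : pres_class (repr g) = g.
Proof. exact: reprK. Qed.

Lemma pres_eq_repr u : pres_eq rels (repr (pres_class u)) u.
Proof. by apply/pres_classP; exact: pres_class_repr. Qed.

Lemma pres_mulE u v : pres_mul (pres_class u) (pres_class v) = pres_class (u ++ v).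
Proof. by apply/pres_classP; apply: pres_cat; exact: pres_eq_repr. Qed.

Lemma word_invK : involutive word_inv.
Proof.
move=> u; rewrite /word_inv map_rev revK -map_comp -[RHS]map_id.
by apply: eq_map => -[x b] /=; rewrite negbK.
Qed.

Lemma word_invr u : pres_eq rels (u ++ word_inv u) [::].
Proof.
elim: u => [|[x b] u IHu]; first exact: pres_refl.
rewrite /word_inv /= rev_cons -cats1 catA -cat_cons -cat1s -catA.
apply: pres_trans (pres_cancel rels x b).
rewrite -[X in pres_eq _ _ X]/([:: (x, b)] ++ [:: (x, ~~ b)]).
apply: pres_cat (pres_refl _ _) _.
rewrite -[X in pres_eq _ _ X]cat0s.
by apply: pres_cat (pres_refl _ _).
Qed.

Lemma pres_mulA : associative pres_mul.
Proof.
move=> f g h; rewrite -(pres_class_repr f) -(pres_class_repr g).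
by rewrite -(pres_class_repr h) !pres_mulE catA.
Qed.

Lemma pres_mul1 : left_id pres_one pres_mul.
Proof. by move=> g; rewrite -(pres_class_repr g) pres_mulE. Qed.

Lemma pres_mulr1 : right_id pres_one pres_mul.
Proof. by move=> g; rewrite -(pres_class_repr g) pres_mulE cats0. Qed.

Lemma pres_mulrV : right_inverse pres_one pres_inv pres_mul.
Proof.
move=> g; rewrite -{1}(pres_class_repr g) pres_mulE.
by apply/pres_classP; exact: word_invr.
Qed.

Lemma pres_mulV : left_inverse pres_one pres_inv pres_mul.
Proof.
move=> g; rewrite -{2}(pres_class_repr g) pres_mulE.
apply/pres_classP; rewrite -{2}(word_invK (repr g)); exact: word_invr.
Qed.

HB.instance Definition _ :=
  isGroup.Build presented_group pres_mulA pres_mul1 pres_mulr1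
    pres_mulV pres_mulrV.

End Presentation.

Definition gen_a : 'I_3 := @Ordinal 3 0 isT.
Definition gen_b : 'I_3 := @Ordinal 3 1 isT.
Definition gen_t : 'I_3 := @Ordinal 3 2 isT.

Definition G_rels : seq (word 'I_3 * word 'I_3) :=
  [:: ([:: pos gen_t; pos gen_a; neg gen_t], [:: pos gen_a; pos gen_b]);
      ([:: pos gen_t; pos gen_b; neg gen_t], [:: pos gen_b])].

Definition G : groupType := presented_group G_rels.

(* A simplicial tree is encoded by its vertices and adjacency relation.       *)
(* "ucycle adj c" says that c is a closed edge path without repeated          *)
(* vertices; those of size 2 just run back and forth along an edge.           *)
Definition is_tree (V : choiceType) (adj : rel V) : Prop :=
  [/\ inhabited V,
      symmetric adj /\ irreflexive adj,
      forall x y, exists2 p, path adj x p & last x p = y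
    & forall c : seq V, ucycle adj c -> size c < 3].

Record tree := Tree {
  vertex :> choiceType;
  adj : rel vertex;
  treeP : is_tree adj }.

Definition locally_finite (T : tree) : Prop :=
  forall x : T, finite_set [set y : T | adj x y].

Definition is_aut (T : tree) (f : T -> T) : Prop :=
  bijective f /\ {mono f : x y / adj x y}.

Record aut (T : tree) := Aut {
  aut_fun :> T -> T;
  aut_funP : `[< is_aut aut_fun >] }.

Section AutGroup.
Variable T : tree.

HB.instance Definition _ := [isSub for @aut_fun T].
HB.instance Definition _ := [Choice of aut T by <:].

Implicit Types f g h : aut T.

Lemma is_aut_aut f : is_aut f.
Proof. exact/asboolP/aut_funP. Qed.

Lemma is_aut_id : is_aut (id : T -> T).
Proof. by split => //; exists id. Qed.

Lemma is_aut_comp f g : is_aut (f \o g).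
Proof.
have [[bf mf] [bg mg]] := (is_aut_aut f, is_aut_aut g).
by split=> [|x y /=]; [exact: bij_comp | rewrite mf mg].
Qed.

Lemma aut_inv_ex f : exists f' : T -> T, cancel f f' /\ cancel f' f.
Proof. by have [[f' fK f'K] _] := is_aut_aut f; exists f'. Qed.

Definition aut_inv_fun f : T -> T := projT1 (cid (aut_inv_ex f)).

Lemma aut_inv_funK f : cancel f (aut_inv_fun f) /\ cancel (aut_inv_fun f) f.
Proof. exact: (projT2 (cid (aut_inv_ex f))). Qed.

Lemma is_aut_inv f : is_aut (aut_inv_fun f).
Proof.
have [fK fVK] := aut_inv_funK f; have [_ mf] := is_aut_aut f.
by split=> [|x y]; [exists f | rewrite -mf !fVK].
Qed.

Definition aut_one : aut T := Aut (asboolT is_aut_id).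
Definition aut_mul f g : aut T := Aut (asboolT (is_aut_comp f g)).
Definition aut_inv f : aut T := Aut (asboolT (is_aut_inv f)).

Lemma aut_mulA : associative aut_mul.
Proof. by move=> f g h; exact: val_inj. Qed.

Lemma aut_mul1 : left_id aut_one aut_mul.
Proof. by move=> f; exact: val_inj. Qed.

Lemma aut_mulr1 : right_id aut_one aut_mul.
Proof. by move=> f; exact: val_inj. Qed.

Lemma aut_mulV : left_inverse aut_one aut_inv aut_mul.
Proof.
by move=> f; apply: val_inj; apply/funext => x /=; rewrite (aut_inv_funK f).1.
Qed.

Lemma aut_mulrV : right_inverse aut_one aut_inv aut_mul.
Proof.
by move=> f; apply: val_inj; apply/funext => x /=; rewrite (aut_inv_funK f).2.
Qed.

HB.instance Definition _ :=
  isGroup.Build (aut T) aut_mulA aut_mul1 aut_mulr1 aut_mulV aut_mulrV.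

End AutGroup.

Definition prod_group (I : Type) (H : I -> groupType) : Type := forall i, H i.

Section ProdGroup.
Variables (I : Type) (H : I -> groupType).

HB.instance Definition _ := gen_eqMixin (prod_group H).
HB.instance Definition _ := gen_choiceMixin (prod_group H).

Implicit Types f g h : prod_group H.

Definition prod_one : prod_group H := fun i => 1.
Definition prod_mul f g : prod_group H := fun i => f i * g i.
Definition prod_inv f : prod_group H := fun i => (f i)^-1.

Lemma prod_mulA : associative prod_mul.
Proof. by move=> f g h; apply: functional_extensionality_dep => i; exact: mulgA. Qed.

Lemma prod_mul1 : left_id prod_one prod_mul.
Proof. by move=> f; apply: functional_extensionality_dep => i; exact: mul1g. Qed.

Lemma prod_mulr1 : right_id prod_one prod_mul.
Proof. by move=> f; apply: functional_extensionality_dep => i; exact: mulg1. Qed.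

Lemma prod_mulV : left_inverse prod_one prod_inv prod_mul.
Proof. by move=> f; apply: functional_extensionality_dep => i; exact: mulVg. Qed.

Lemma prod_mulrV : right_inverse prod_one prod_inv prod_mul.
Proof. by move=> f; apply: functional_extensionality_dep => i; exact: mulgV. Qed.

HB.instance Definition _ :=
  isGroup.Build (prod_group H) prod_mulA prod_mul1 prod_mulr1
    prod_mulV prod_mulrV.

End ProdGroup.

Definition aut_prod (k : nat) (T : 'I_k -> tree) : groupType :=
  prod_group (fun i => aut (T i)).

Definition prod_vertex (k : nat) (T : 'I_k -> tree) : Type := forall i, T i.

Definition prod_act (k : nat) (T : 'I_k -> tree) (f : aut_prod T)
  (v : prod_vertex T) : prod_vertex T := fun i => f i (v i).

Definition proper_action (H : groupType) (k : nat) (T : 'I_k -> tree)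
    (rho : {multiplicative H -> aut_prod T}) : Prop :=
  forall v : prod_vertex T, finite_set [set g : H | prod_act (rho g) v = v].

(* Main.v *)
Require Import Defs.
From HB Require Import structures.
From mathcomp Require Import all_boot all_order all_algebra.
From mathcomp Require Import boolp classical_sets cardinality functions.
From mathcomp Require Import zify ring lra.

(* The relations say that t commutes with b and that a conjugates t to bt.
   In each tree there are a vertex v and N > 0 such that b^M and a^-1 b^M a
   commute at v whenever N divides M.  If some power of b fixes a vertex v, local
   finiteness gives a further power that also fixes a v.  Otherwise b translates
   an axis; t commutes with b, so it translates this axis as well, and neither t
   nor bt fixes a vertex, since they are conjugate and not both trivial on the
   axis.  Hence both have this line as their unique axis, so a preserves it, and
   b and a^-1 b a both act on it by translations.
   For a common M, all powers of w = [b^M, a^-1 b^M a] thus fix a vertex of the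
   product, whereas w has infinite order, as an affine action of G on Q^2 shows. *)

Set Implicit Arguments.
Unset Strict Implicit.
Unset Printing Implicit Defensive.

Import GRing.Theory Num.Theory.

(** * Distance in a tree *)

Section Distance.
Variable T : tree.
Implicit Types (x y z w u v : T) (g : aut T).

Lemma dist_ex x y :
  exists n, `[< exists p, [/\ path (@adj T) x p, last x p = y & size p = n] >].
Proof.
have [_ _ conn _] := treeP T; have [p xp py] := conn x y.
by exists (size p); apply/asboolP; exists p.
Qed.

Definition dist x y : nat := ex_minn (dist_ex x y).

Lemma dist_path x y :
  exists p, [/\ path (@adj T) x p, last x p = y & size p = dist x y].
Proof. by rewrite /dist; case: ex_minnP => n /asboolP. Qed.

Lemma dist_min x p : path (@adj T) x p -> dist x (last x p) <= size p.
Proof.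
by move=> xp; rewrite /dist; case: ex_minnP => n _; apply; apply/asboolP; exists p.
Qed.

Lemma adjC x y : adj x y = adj y x.
Proof. by have [_ [sT _] _ _] := treeP T; exact: sT. Qed.

Lemma dist_eq0 x y : (dist x y == 0) = (x == y).
Proof.
apply/eqP/eqP => [d0|->]; last first.
  by apply/eqP; rewrite -leqn0; exact: (@dist_min y [::]).
by have [p [_ py /eqP]] := dist_path x y; rewrite d0 size_eq0 -py => /eqP->.
Qed.

Lemma distxx x : dist x x = 0. Proof. by apply/eqP; rewrite dist_eq0. Qed.

Lemma dist_adj x y : adj x y -> dist x y = 1.
Proof.
move=> xy; have [_ [_ iT] _ _] := treeP T.
have: dist x y <= 1 by apply: (@dist_min x [:: y]); rewrite /= xy.
have: dist x y != 0 by rewrite dist_eq0; apply: contraTneq xy => ->; rewrite iT.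
lia.
Qed.

Lemma dist_triangle x y z : dist x z <= dist x y + dist y z.
Proof.
have [[p [xp py <-]] [q [yq qz <-]]] := (dist_path x y, dist_path y z).
by rewrite -size_cat -qz -py -last_cat; apply: dist_min; rewrite cat_path xp py.
Qed.

Lemma dist_le_sym x y : dist x y <= dist y x.
Proof.
have [p [yp px <-]] := dist_path y x.
have := @dist_min (last y p) (rev (belast y p)).
rewrite rev_path (eq_path (e' := @adj T)) => [|u v]; last exact: adjC.
move=> /(_ yp); rewrite size_rev size_belast px.
by case: p yp px => [|z p] /= _ => [->|_] //; rewrite rev_cons last_rcons.
Qed.

Lemma distC x y : dist x y = dist y x.
Proof. by apply/eqP; rewrite eqn_leq !dist_le_sym. Qed.

Lemma dist_pred x y n : dist x y = n.+1 -> exists2 z, adj z y & dist x z = n.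
Proof.
move=> dxy; have [p [xp py]] := dist_path x y; rewrite dxy.
case/lastP: p xp py => // p z; rewrite rcons_path last_rcons size_rcons.
move=> /andP[xp pz] zy [szp]; exists (last x p); first by rewrite -zy.
have := dist_min xp; have := dist_triangle x (last x p) y.
by rewrite -{2}zy (dist_adj pz) dxy szp; lia.
Qed.

Lemma dist_mid x y k : k <= dist x y ->
  exists2 z, dist x z = k & dist z y = dist x y - k.
Proof.
move: {2}(_ - k) (erefl (dist x y - k)) => m; elim: m y => [|m IHm] y dm lek.
  by exists y; rewrite ?distxx; lia.
have [z zy dxz] := @dist_pred x y (k + m) ltac:(lia).
have [w dxw dwz] := IHm z ltac:(lia) ltac:(lia).
exists w => //; have := dist_triangle w z y; have := dist_triangle x w y.
by rewrite (dist_adj zy); lia.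
Qed.

Lemma dist_aut_le g x y : dist (g x) (g y) <= dist x y.
Proof.
have [p [xp py <-]] := dist_path x y; rewrite -py -last_map.
rewrite -(size_map g p); apply: dist_min; rewrite path_map.
by rewrite (eq_path (e' := @adj T)) // => u v /=; have [_ ->] := is_aut_aut g.
Qed.

Lemma autMx g h x : (g * h)%g x = g (h x). Proof. by []. Qed.

Lemma aut1x x : (1%g : aut T) x = x. Proof. by []. Qed.

Lemma autKx g x : g^-1%g (g x) = x.
Proof. by rewrite -autMx mulVg. Qed.

Lemma autKVx g x : g (g^-1%g x) = x.
Proof. by rewrite -autMx mulgV. Qed.

Lemma autX_fix g x k : g x = x -> (g ^+ k)%g x = x.
Proof. by move=> gx; elim: k => // k IHk; rewrite expgS autMx IHk. Qed.

Lemma dist_aut g x y : dist (g x) (g y) = dist x y.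
Proof.
apply/eqP; rewrite eqn_leq dist_aut_le /=.
by rewrite -{1}(autKx g x) -{1}(autKx g y) dist_aut_le.
Qed.

(* Extending the path downwards by neighbours one step closer to [o] must
   eventually close it up into a simple cycle. *)
Lemma no_sphere_path o n x p : path (@adj T) x p -> uniq (x :: p) -> p != [::] ->
  dist o x = n -> dist o (last x p) = n ->
  all (fun v => n <= dist o v) (x :: p) -> False.
Proof.
have [_ [_ _] _ acyc] := treeP T.
elim: n x p => [|n IHn] x p xp up p0 dx dp ge.
  move/eqP: dx; rewrite dist_eq0 => /eqP ox; move/eqP: dp.
  rewrite dist_eq0 => /eqP op; case: p xp up p0 op {ge} => [|z p] //= _.
  by move=> /andP[+ _] _ zp; rewrite -ox {1}zp mem_last.
have [[x' x'x dx'] [y' y'y dy']] := (dist_pred dx, dist_pred dp).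
have notin z : dist o z = n -> z \notin x :: p.
  by move=> dz; apply/negP => /(allP ge); rewrite dz ltnn.
have [eq|neq] := eqVneq x' y'.
  suff /acyc : ucycle (@adj T) [:: x', x & p] by case: (p) p0.
  rewrite /ucycle cons_uniq notin // up !andbT.
  by rewrite /= rcons_path x'x xp eq adjC y'y.
apply: (IHn x' (rcons (x :: p) y')) => //.
- by rewrite rcons_path /= x'x xp adjC.
- by rewrite cons_uniq rcons_uniq mem_rcons inE negb_or neq !notin.
- by rewrite last_rcons.
rewrite -rcons_cons all_rcons dy' leqnn /= dx' leqnn /=.
by apply: sub_all (ge : all _ (x :: p)) => z /ltnW.
Qed.

(** Trees are bipartite: an edge inside a sphere around [o] would be a path forbidden by
    [no_sphere_path]. *)
Lemma dist_neighbour o x y : adj x y -> dist o y != dist o x.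
Proof.
move=> xy; apply/eqP => dxy.
apply: (@no_sphere_path o _ x [:: y] _ _ _ erefl) => //=; rewrite ?xy ?dxy ?leqnn //.
by rewrite inE andbT; apply: contraTneq xy => ->; have [_ [_ ->]] := treeP T.
Qed.

Lemma dist_neighbourP o x y : adj x y ->
  dist o y = (dist o x).+1 \/ dist o x = (dist o y).+1.
Proof.
move=> xy; have := dist_neighbour o xy; have := dist_triangle o x y.
have := dist_triangle o y x; rewrite (distC y x) (dist_adj xy); lia.
Qed.

(** Otherwise [x], [z], [y] would be a simple path with both ends on one sphere and its middle
    further out. *)
Lemma parent_uniq o x y z : adj x z -> adj y z ->
  dist o z = (dist o x).+1 -> dist o z = (dist o y).+1 -> x = y.
Proof.
move=> xz yz dx dy; apply/eqP/negPn/negP => neq.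
apply: (@no_sphere_path o _ x [:: z; y] _ _ _ erefl) => //=.
- by rewrite xz adjC yz.
- rewrite !inE negb_or neq !andbT.
  by apply/andP; split; apply/eqP => e; move: dx dy; rewrite e; lia.
- lia.
- by rewrite leqnn dx; lia.
Qed.

(** Local geodesics are global. If the distance from [x] dropped at the next step, from [w] to [s],
    then [s] would be a second parent of [w], hence equal to [u], whereas the path leads away from
    [u]. *)
Lemma geodesic_extend x u w z : adj u w -> dist x w = (dist x u).+1 ->
  dist u z = (dist w z).+1 -> dist x z = dist x w + dist w z.
Proof.
move: {2}(dist w z) (erefl (dist w z)) => n; elim: n u w => [|n IHn] u w dn uw.
  by move=> _ _; rewrite dn; move/eqP: dn; rewrite dist_eq0 => /eqP<-; lia.
move=> dxw duz; move: (dn); rewrite distC => /dist_pred[s sw ds].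
have dxs : dist x s = (dist x w).+1.
  have [//|dxw'] := @dist_neighbourP x w s ltac:(by rewrite adjC).
  have us := parent_uniq uw sw dxw dxw'.
  by move: duz; rewrite us distC ds; lia.
rewrite distC in ds; have := IHn w s ds; rewrite adjC dxs ds dn => -> //.
by rewrite [dist z w]distC dn addSnnS.
Qed.

(** Contrapositive of [geodesic_extend], for the last edge of a geodesic from [x] to [w]: if that
    edge did not also lead back towards [z], the two geodesics would concatenate. *)
Lemma first_step x w z : dist x z < dist x w + dist w z ->
  exists u, [/\ adj u w, dist x w = (dist x u).+1 & dist w z = (dist u z).+1].
Proof.
case dw: (dist x w) => [|n] lt.
  by move/eqP: dw lt; rewrite dist_eq0 => /eqP->; rewrite ltnn.
have [u uw du] := dist_pred dw; exists u; split; rewrite ?du //.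
have [|] := dist_neighbourP z uw; rewrite ![dist z _]distC // => duz.
have dxw : dist x w = (dist x u).+1 by rewrite dw du.
by have := geodesic_extend uw dxw duz; lia.
Qed.

(* Unless one of the two triangles is degenerate at [w], the first steps from [w]
   towards [x] and [y] are both the first step towards [z]: move [w] along it. *)
Lemma four_point x y z w :
  dist x y + dist z w <= maxn (dist x z + dist y w) (dist x w + dist y z).
Proof.
have [n] := ubnP (dist z w); elim: n w => // n IHn w lt.
have tri := dist_triangle x w y; rewrite [dist w y]distC in tri.
have trx := dist_triangle x w z; have try := dist_triangle y w z.
have zw := distC z w.
have [ltx|] := ltnP (dist x z) (dist x w + dist w z); last by lia.
have [lty|] := ltnP (dist y z) (dist y w + dist w z); last by lia.
have [u [uw dxu duz]] := first_step ltx.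
have [v [vw dyv dvz]] := first_step lty.
have uv : u = v by apply: (@parent_uniq z u v w) => //; rewrite ![dist z _]distC.
rewrite -uv in dyv; have := IHn u; rewrite [dist z u]distC; lia.
Qed.

(** In the four-point inequality for [x], [y], [z], [z'] both sums on the right equal [dist x y],
    which leaves [dist z z' = 0]. *)
Lemma dist_mid_inj x y z z' : dist x z + dist z y = dist x y ->
  dist x z = dist x z' -> dist z y = dist z' y -> z = z'.
Proof.
move=> mid e e'; apply/eqP; rewrite -dist_eq0; have := four_point x y z z'.
rewrite [dist y _]distC [dist y _]distC; lia.
Qed.

Lemma sphere_finite x n : locally_finite T -> finite_set [set y | dist x y = n].
Proof.
move=> lf; elim: n => [|n IHn].
  apply: (sub_finite_set _ (finite_set1 x)) => y /= /eqP.
  by rewrite dist_eq0 => /eqP->.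
apply: (sub_finite_set _ (bigcup_finite IHn (fun z _ => lf z))) => y /= /dist_pred.
by move=> [z zy dz]; exists z.
Qed.

End Distance.

(** * Lines and axes *)

Section Lines.
Variable T : tree.
Implicit Types (x y z w u v : T) (g h : aut T) (l : int -> T) (m n : int).

(** A line comes with a parametrisation, hence a direction, so translation lengths are signed. *)
Definition line l := forall m n, dist (l m) (l n) = `|m - n|%N.

Definition translates g l m := forall n, g (l n) = l (n + m)%R.

Lemma translatesX g l m k : translates g l m -> translates (g ^+ k)%g l (m *+ k)%R.
Proof.
move=> gl; elim: k => [|k IHk] n; first by rewrite expg0 aut1x; congr l; lia.
by rewrite expgS autMx IHk gl; congr l; lia.
Qed.

Lemma translatesV g l m : translates g l m -> translates g^-1%g l (- m)%R.
Proof.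
by move=> gl n; rewrite -[RHS](autKx g) gl; congr ((g^-1)%g (l _)); lia.
Qed.

Lemma translation_fixfree g l m y : line l -> translates g l m -> m <> 0%R ->
  g y <> y.
Proof.
move=> ll gl m0 gy.
(* A power of [g] fixing [y] moves [l 0] by at most twice its distance to [y]; [k] exceeds this
   bound. *)
pose k := (dist y (l 0%R)).*2.+1.
have := dist_aut (g ^+ k)%g y (l 0%R); rewrite autX_fix // (translatesX k gl) add0r.
have := dist_triangle (l 0%R) y (l (m *+ k)%R); rewrite ll distC /k; nia.
Qed.

(** Powers of [g] carry [l 0] and [l' 0] far out in both directions at constant distance [D]; in a
    tree the two lines then agree in between. What remains is an isometric self-map of the
    integers. *)
Lemma axis_uniq g l l' m m' : line l -> line l' ->
    translates g l m -> translates g l' m' -> m <> 0%R -> m' <> 0%R ->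
  exists e c : int, (e = 1%R \/ e = (-1)%R) /\ forall n, l' n = l (e * n + c)%R.
Proof.
move=> ll ll' gl gl' m0 m'0.
have in_l n : exists p : int, l' n = l p.
  set D := dist (l 0%R) (l' 0%R).
  set K := (`|n| + D + 1)%N; set M : int := (m *+ K)%R; set M' : int := (m' *+ K)%R.
  have pp' : dist (l (- M)%R) (l' (- M')%R) = D.
    rewrite /D -[RHS](dist_aut (g^-1 ^+ K)%g) (translatesX K (translatesV gl)).
    by rewrite (translatesX K (translatesV gl')) !add0r !mulNrn.
  have qq' : dist (l M) (l' M') = D.
    rewrite /D -[RHS](dist_aut (g ^+ K)%g) (translatesX K gl).
    by rewrite (translatesX K gl') !add0r.
  have [KM KM'] : (K <= `|M| /\ K <= `|M'|)%N by rewrite /M /M'; split; nia.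
  have D0 : (K = `|n| + D + 1)%N by [].
  clearbody M M' K D.
  have := four_point (l' (- M')%R) (l' M') (l' n) (l (- M)%R).
  (* As [|M'|] exceeds [|n| + D], the sum containing [D] is not the larger one in either inequality.
     The other two place [l' n] on the segment from [l (- M)] to [l M]. *)
  have := four_point (l (- M)%R) (l' M') (l' n) (l M).
  rewrite !ll' ll [dist (l' (- M')%R) (l _)]distC pp' [dist (l' M') (l M)]distC qq'.
  rewrite ![dist (l' _) (l _)]distC => f1 f2.
  have mid : dist (l (- M)%R) (l' n) + dist (l' n) (l M) = dist (l (- M)%R) (l M).
    rewrite [dist (l' n) _]distC ll.
    have := dist_triangle (l (- M)%R) (l' n) (l M); rewrite ll [dist (l' n) _]distC.
    lia.
  pose r := dist (l (- M)%R) (l' n).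
  have rM : (r <= 2 * `|M|)%N by move: mid; rewrite -/r ll; lia.
  (* The parameter at distance [r] from [- M] in the direction of [M]. *)
  exists (if (0 <= M)%R then - M + r%:Z else - M - r%:Z)%R.
  apply: (dist_mid_inj mid); rewrite -/r ?ll; first by case: ifP; lia.
  by move: mid; rewrite -/r !ll; case: ifP; lia.
have [f lf] := choice in_l.
have iso (i j : int) : `|f i - f j|%N = `|i - j|%N by rewrite -ll -!lf ll'.
have f01 := iso 1%R 0%R.
have [f1|f1] : (f 1 - f 0 = 1 \/ f 1 - f 0 = -1)%R by lia.
  exists 1%R, (f 0%R); split=> [|n]; first by left.
  by rewrite lf; congr l; have := iso n 0%R; have := iso n 1%R; lia.
exists (-1)%R, (f 0%R); split=> [|n]; first by right.
by rewrite lf; congr l; have := iso n 0%R; have := iso n 1%R; lia.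
Qed.

Definition zpow g n : aut T :=
  match n with Posz k => (g ^+ k)%g | Negz k => (g^-1 ^+ k.+1)%g end.

Lemma zpowS g n x : zpow g (n + 1)%R x = g (zpow g n x).
Proof.
case: n => [k|[|k]].
- by rewrite -PoszD addn1 /= expgS.
- by rewrite /zpow expg1 autKVx.
- have -> : (Negz k.+1 + 1 = Negz k)%R by lia.
  by rewrite /zpow [(_ ^+ k.+2)%g]expgS autMx autKVx.
Qed.

Lemma zpow_commute g n : commute (zpow g n) g.
Proof.
case: n => k; apply/commute_sym/commuteX; first exact: commute_refl.
exact/commuteV/commute_refl.
Qed.

Lemma min_displacement g : exists x, forall y, dist x (g x) <= dist y (g y).
Proof.
have [[x0] _ _ _] := treeP T.
have ex : exists n : nat, `[< exists x, dist x (g x) = n >].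
  by exists (dist x0 (g x0)); apply/asboolP; exists x0.
case: (ex_minnP ex) => k /asboolP[x <-] xmin; exists x => y.
by apply: xmin; apply/asboolP; exists y.
Qed.

(* A vertex of minimal displacement lies on the axis. *)
Lemma dist_square g x : g x <> x -> g (g x) <> x ->
    (forall y, dist x (g x) <= dist y (g y)) ->
  dist x (g (g x)) = 2 * dist x (g x).
Proof.
move=> gx ggx xmin; have := dist_triangle x (g x) (g (g x)).
rewrite dist_aut => tri.
have [lt|] := ltnP (dist x (g (g x))) (dist x (g x) + dist (g x) (g (g x))); last first.
  by rewrite dist_aut; lia.
(* If the geodesics from [g x] to [x] and to [g (g x)] share the edge to [s], the neighbour [p] of
   [x] is displaced less than [x]. The exception [x = s] is an edge inversion, where
   [g (g x) = x]. *)
have [s [sgx dxs dgs]] := first_step lt; rewrite dist_aut dxs in dgs.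
pose p := (g^-1)%g s; have gp : g p = s by rewrite /p autKVx.
have dpx : dist p x = 1 by rewrite -(dist_aut g) gp dist_adj.
have dp : dist p (g x) = dist x s.
  by rewrite -(dist_aut g) gp; lia.
have := four_point p s x (g x); rewrite dp dpx (dist_adj sgx) [dist s x]distC.
have := xmin p; rewrite gp dxs.
have [xs|] := eqVneq x s; last by rewrite -dist_eq0; lia.
move/eqP: dgs; rewrite xs distxx eqSS eq_sym dist_eq0 -xs eq_sym => /eqP e.
by case: ggx.
Qed.

(** The hypotheses exclude fixed vertices and edge inversions, so [g] is hyperbolic. Its axis runs
    through the orbit of a vertex of minimal displacement. *)
Lemma axis_exists g : (forall x, g x <> x) -> (forall x, g (g x) <> x) ->
  exists l m, [/\ line l, m <> 0%R & translates g l m].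
Proof.
move=> gx ggx; have [x xmin] := min_displacement g.
have d2 := dist_square (gx x) (ggx x) xmin.
have : dist x (g x) != 0 by rewrite dist_eq0; apply/eqP => /esym; exact: gx.
move: d2; set m := dist x (g x) => d2 m0.
pose y n := zpow g n x.
have yS n : y (n + 1)%R = g (y n) by exact: zpowS.
have step (i j : int) : dist (y (i + 1)%R) (y (j + 1)%R) = dist (y i) (y j).
  by rewrite !yS dist_aut.
have y1 n : dist (y n) (y (n + 1)%R) = m.
  elim/int_rect: n => [|k IH|k IH]; first by rewrite yS.
    have -> : (k.+1%:Z = k%:Z + 1)%R by lia.
    by rewrite step.
  rewrite -IH -step; congr (dist (y _) (y _)); lia.
have y2 n : dist (y n) (y (n + 1 + 1)%R) = 2 * m.
  elim/int_rect: n => [|k IH|k IH]; first by rewrite !yS.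
    have -> : (k.+1%:Z = k%:Z + 1)%R by lia.
    by rewrite step.
  rewrite -IH -step; congr (dist (y _) (y _)); lia.
(* Distances along the orbit add up: the four-point inequality yields the distance over [k + 2]
   steps from those over [k] and [k + 1], hence the paired induction. *)
have yD n k : dist (y n) (y (n + k%:Z)%R) = k * m
    /\ dist (y n) (y (n + k%:Z + 1)%R) = k.+1 * m.
  elim: k => [|k [IH1 IH2]]; first by rewrite addr0 distxx y1; lia.
  have e : (n + k.+1%:Z = n + k%:Z + 1)%R by lia.
  rewrite e; split=> //.
  have := four_point (y n) (y (n + k%:Z + 1)%R) (y (n + k%:Z)%R) (y (n + k%:Z + 1 + 1)%R).
  have := dist_triangle (y n) (y (n + k%:Z + 1)%R) (y (n + k%:Z + 1 + 1)%R).
  rewrite [dist (y (n + k%:Z + 1)%R) (y (n + k%:Z)%R)]distC.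
  rewrite y2 !y1 IH1 IH2; nia.
have yy (i j : int) : (i <= j)%R -> dist (y i) (y j) = `|j - i|%N * m.
  move=> ij; have [+ _] := yD i `|j - i|%N; have -> : (i + `|j - i|%N = j)%R by lia.
  by [].
(* [c i] runs along a geodesic from [x] to [g x]; beyond [m] its value is arbitrary. *)
have /choice[c cP] : forall i, exists z, i <= m -> dist x z = i /\ dist z (g x) = m - i.
  move=> i; have [im|] := leqP i m; last by exists x.
  by have [z xz zg] := dist_mid im; exists z.
have cP1 i k : i <= m ->
    dist (y k) (zpow g k (c i)) = i /\ dist (zpow g k (c i)) (y (k + 1)%R) = m - i.
  move=> /cP[d1 d2'].
  have -> : y (k + 1)%R = zpow g k (g x).
    by rewrite yS -[RHS]autMx zpow_commute.
  by rewrite /y !dist_aut.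
(* The axis is the union of the translates of a geodesic from [x] to [g x]. *)
exists (fun n => zpow g (n %/ m)%Z (c `|(n %% m)%Z|%N)), m; split.
- move=> i j; wlog ij : i j / (i <= j)%R.
    move=> H; have [/H //|/H] : (i <= j \/ j <= i)%R by lia.
    by rewrite distC => ->; lia.
  set k := (i %/ m)%Z; set k' := (j %/ m)%Z.
  set r := `|(i %% m)%Z|%N; set r' := `|(j %% m)%Z|%N.
  have ei : (i = k * m%:Z + r%:Z)%R by rewrite /k /r gez0_abs ?modz_ge0 -?divz_eq //; lia.
  have ej : (j = k' * m%:Z + r'%:Z)%R by rewrite /k' /r' gez0_abs ?modz_ge0 -?divz_eq //; lia.
  have rm : r < m by rewrite -ltz_nat /r gez0_abs ?modz_ge0 ?ltz_pmod //; lia.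
  have rm' : r' < m by rewrite -ltz_nat /r' gez0_abs ?modz_ge0 ?ltz_pmod //; lia.
  have kk' : (k <= k')%R by nia.
  have [d1 e1] := cP1 _ k (ltnW rm); have [d2' e2] := cP1 _ k' (ltnW rm').
  set z := zpow g k (c r) in d1 e1 *; set z' := zpow g k' (c r') in d2' e2 *.
  have := dist_triangle (y k) z (y (k' + 1)%R).
  have := dist_triangle z z' (y (k' + 1)%R); rewrite d1 e2 yy; last by lia.
  (* Within one segment the four-point inequality decides; otherwise the route through the ends of
     the segments does. *)
  have [keq|klt] : k = k' \/ (k + 1 <= k')%R by lia.
    have := four_point z z' (y k) (y (k + 1)%R); rewrite y1 ![dist _ (y k)]distC.
    rewrite d1 e1 keq d2' e2; nia.
  have := dist_triangle z (y (k + 1)%R) z'.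
  have := dist_triangle (y (k + 1)%R) (y k') z'; rewrite d2' e1 (yy _ _ klt).
  nia.
- lia.
- move=> n; rewrite modzDr divzDr ?dvdzz // divzz.
  have -> : (m%:Z == 0)%R = false by lia.
  by rewrite zpowS.
Qed.

End Lines.

(** * Local action on one tree *)

Section TreeAction.
Variable T : tree.
Implicit Types (x y v w : T) (g h : aut T).

Lemma commg_fix g h x : (g * h)%g x = (h * g)%g x -> [~ g, h]%g x = x.
Proof. by rewrite commgEl conjgE !autMx => ->; rewrite !autKx. Qed.

(** The orbit of [w] stays on a sphere around [v], which is finite, so two powers of [h] agree at
    [w]. *)
Lemma finite_orbit h v w : locally_finite T -> h v = v ->
  exists2 k, 0 < k & (h ^+ k)%g w = w.
Proof.
move=> lf hv; pose f k := (h ^+ k)%g w.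
have [fI|] := pselect (injective f).
  have := finite_preimage (in2W fI) (sphere_finite v (dist v w) lf).
  suff -> : (f @^-1` [set y | dist v y = dist v w])%classic = setT.
    by move=> /infinite_nat.
  by apply/seteqP; split=> // k _ /=; rewrite -{1}(autX_fix k hv) dist_aut.
have pigeon i j : i < j -> f i = f j -> exists2 k, 0 < k & (h ^+ k)%g w = w.
  move=> ij; rewrite /f -(subnK (ltnW ij)) addnC expgnDr autMx => e.
  exists (j - i); first by rewrite subn_gt0.
  by rewrite -[LHS](autKx (h ^+ i)%g) -e autKx.
move=> /existsNP[i /existsNP[j /not_implyP[fij /eqP]]].
by rewrite neq_ltn => /orP[] ij; exact: pigeon ij _.
Qed.

Lemma conj_powers_commute (a b t : aut T) : locally_finite T ->
    (t * a = a * b * t)%g -> (t * b = b * t)%g ->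
  exists2 N, 0 < N & exists v, forall M, N %| M ->
    (b ^+ M * (b ^+ M) ^ a)%g v = ((b ^+ M) ^ a * b ^+ M)%g v.
Proof.
move=> lf ta tb.
have [[N [N0 [v bv]]]|nfix] := pselect (exists N, 0 < N /\ exists v, (b ^+ N)%g v = v).
  have [k k0 bkav] := finite_orbit (a v) lf bv.
  (* This power of [b] fixes both [v] and [a v], so its multiples and their conjugates by [a] fix
     [v]. *)
  exists (N * k); first by rewrite muln_gt0 N0.
  exists v => M /dvdnP[q ->]; rewrite mulnC expgnA.
  have bM : ((b ^+ (N * k)) ^+ q)%g v = v by rewrite autX_fix // expgnA autX_fix.
  have bMa : ((b ^+ (N * k)) ^+ q)%g (a v) = a v by rewrite autX_fix // expgnA.
  by rewrite conjgE !autMx bM bMa autKx bM.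
have [||l [m [ll m0 bl]]] := @axis_exists T b.
- by move=> x bx; apply: nfix; exists 1; split=> //; exists x.
- by move=> x bx; apply: nfix; exists 2; split=> //; exists x.
have lg g : line (fun n => g (l n)) by move=> i j; rewrite dist_aut ll.
have btl : translates b (fun n => t (l n)) m.
  by move=> n; rewrite -autMx -tb autMx bl.
have [e [c [eE tl]]] := axis_uniq ll (lg t) bl btl m0 m0.
(* If [t] reversed the axis, [t b] and [b t] would send [l 0] to vertices [2|m|] apart. *)
have tlc : translates t l c.
  have := ll 0%R 0%R.
  have : dist (t (b (l 0%R))) (b (t (l 0%R))) = 0.
    by rewrite -!autMx tb distxx.
  rewrite bl !tl bl ll => d0 _ n; rewrite tl; congr l; case: eE => eE; subst e; lia.
(* The first relation read as a conjugacy: [b t] and [t] share the line [l], with translation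
   lengths [c + m] and [c]. *)
have bta y : (b * t)%g y = (a^-1 * t * a)%g y.
  by rewrite -!mulgA ta mulgA mulgA mulVg mul1g.
have btlc : translates (b * t)%g l (c + m)%R.
  by move=> n; rewrite autMx tlc bl addrA.
(* A zero length for one of the two gives it a fixed vertex, hence one for its conjugate, whose
   length is then nonzero. *)
have c0 : c <> 0%R.
  move=> c0; apply: (@translation_fixfree T (b * t)%g l (c + m)%R (a^-1%g (l 0%R)) ll btlc).
    by rewrite c0 add0r.
  by rewrite bta !autMx autKVx tlc c0.
have cm0 : (c + m)%R <> 0%R.
  move=> cm0; apply: (@translation_fixfree T t l c (a (l 0%R)) ll tlc c0).
  by rewrite -autMx ta -mulgA autMx btlc cm0 addr0.
have btal : translates (b * t)%g (fun n => a^-1%g (l n)) c.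
  by move=> n; rewrite bta !autMx autKVx tlc.
have [e' [c' [eE' al]]] := axis_uniq ll (lg a^-1%g) btlc btal cm0 c0.
have bal : translates (b ^ a)%g l (e' * m)%R.
  move=> n; have [k ->] : exists k : int, n = (e' * k + c')%R.
    by exists (e' * (n - c'))%R; case: eE' => ->; lia.
  rewrite -al conjgE !autMx autKVx bl al; congr l; lia.
exists 1 => //; exists (l 0%R) => M _; rewrite conjXg !autMx.
by rewrite !(translatesX M bl) !(translatesX M bal) !(translatesX M bl); congr l; lia.
Qed.

End TreeAction.

(** * An element of infinite order *)

Section Group.

(* The map of [a] exchanges the coordinates up to a translation, so it conjugates
   [t], which doubles y, to [b t], which doubles x. *)
Definition aff_letter (l : 'I_3 * bool) (p : rat * rat) : (rat * rat)%type :=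
  let: (x, y) := p in
  match val l.1, l.2 with
  | 0, true => (y + 1, x)%R
  | 0, false => (y, x - 1)%R
  | 1, true => (2 * x, y / 2)%R
  | 1, false => (x / 2, 2 * y)%R
  | _, true => (x, 2 * y)%R
  | _, false => (x, y / 2)%R
  end.

Definition aff_word (u : word 'I_3) p := foldr aff_letter p u.

Lemma aff_word_cat u v p : aff_word (u ++ v) p = aff_word u (aff_word v p).
Proof. exact: foldr_cat. Qed.

Lemma aff_word_pres u v : pres_eq G_rels u v -> aff_word u =1 aff_word v.
Proof.
elim=> {u v} [//|u v _ IH p|u v w _ IH1 _ IH2 p|u u' v v' _ IH1 _ IH2 p|x b p|u v].
- by rewrite IH.
- by rewrite IH1.
- by rewrite !aff_word_cat IH1 IH2.
- case: p => p q; case: x b => -[|[|k]] ltk [] /=; congr pair; by field.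
- rewrite !inE => /orP[]/eqP[-> ->] [p q] /=; congr pair; by field.
Qed.

Definition aff (g : G) := aff_word (repr g).

Lemma affE u : aff (pres_class G_rels u) =1 aff_word u.
Proof. exact/aff_word_pres/pres_eq_repr. Qed.

Lemma affM g h p : aff (g * h)%g p = aff g (aff h p).
Proof. by rewrite affE aff_word_cat. Qed.

Lemma aff1 p : aff 1%g p = p. Proof. by rewrite affE. Qed.

Lemma affV g p q : aff g q = p -> aff g^-1%g p = q.
Proof. by move=> <-; rewrite -affM mulVg aff1. Qed.

Lemma pres_class_cat u v :
  pres_class G_rels (u ++ v) = (pres_class G_rels u * pres_class G_rels v)%g.
Proof. exact/esym/pres_mulE. Qed.

Definition Ga : G := pres_class G_rels [:: pos gen_a].
Definition Gb : G := pres_class G_rels [:: pos gen_b].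
Definition Gt : G := pres_class G_rels [:: pos gen_t].

Lemma Gt_inv : pres_class G_rels [:: neg gen_t] = Gt^-1%g.
Proof.
apply/esym/mulg1_eq; rewrite -pres_class_cat.
by apply/pres_classP; exact: pres_cancel.
Qed.

Lemma G_relta : (Gt * Ga = Ga * Gb * Gt)%g.
Proof.
have e : (Gt * Ga * Gt^-1 = Ga * Gb)%g.
  rewrite -Gt_inv -(pres_class_cat [:: pos gen_t] [:: pos gen_a]).
  rewrite -pres_class_cat -(pres_class_cat [:: pos gen_a]).
  exact/pres_classP/pres_rel.
by rewrite -e mulgVK.
Qed.

Lemma G_reltb : (Gt * Gb = Gb * Gt)%g.
Proof.
have e : (Gt * Gb * Gt^-1 = Gb)%g.
  rewrite -Gt_inv -(pres_class_cat [:: pos gen_t] [:: pos gen_b]).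
  rewrite -pres_class_cat; exact/pres_classP/pres_rel.
by rewrite -{2}e mulgVK.
Qed.

Definition comm_b M : G := [~ Gb ^+ M, (Gb ^+ M) ^ Ga]%g.

Lemma aff_Gb M x y : aff (Gb ^+ M)%g (x, y) = (2 ^+ M * x, y / 2 ^+ M)%R.
Proof.
elim: M => [|M IHM]; first by rewrite aff1 mul1r divr1.
rewrite expgS affM IHM affE /= !exprS; congr pair; first by rewrite mulrA.
by rewrite invfM mulrA mulrAC.
Qed.

(** On the second coordinate [b^M] scales about 0 and its conjugate scales about -1, so the
    commutator is a translation. On the first coordinate both scale about 0 and commute. *)
Lemma aff_comm_b M x y :
  aff (comm_b M) (x, y) = (x, y + (2 - 2 ^+ M - 2 ^- M))%R.
Proof.
have q0 : (2 ^+ M != 0 :> rat)%R by rewrite expf_neq0.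
have bJ z w : aff ((Gb ^+ M) ^ Ga)%g (z, w)
    = (z / 2 ^+ M, 2 ^+ M * (w + 1) - 1)%R.
  have aE x1 y1 : aff Ga (x1, y1) = (y1 + 1, x1)%R by rewrite affE.
  by rewrite conjgE affM (affM _ Ga) aE aff_Gb; apply: affV; rewrite aE subrK.
rewrite /comm_b commgEl conjgE affM; apply: affV; rewrite [RHS]affM.
apply/esym/affV; rewrite [RHS]affM bJ !aff_Gb bJ; congr pair; by field.
Qed.

Lemma comm_b_pow_inj M : 0 < M -> injective (fun j => comm_b M ^+ j)%g.
Proof.
move=> M0; pose d : rat := (2 - 2 ^+ M - 2 ^- M)%R.
have powE j : aff (comm_b M ^+ j)%g (0, 0)%R = (0, d *+ j)%R.
  elim: j => [|j IHj]; first by rewrite aff1.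
  by rewrite expgS affM IHj aff_comm_b -/d mulrSr.
have d0 : d != 0%R.
  have q1 : (1 < 2 ^+ M :> rat)%R by rewrite exprn_egt1 // -lt0n.
  (* Up to sign this is a square, nonzero because [2 ^+ M > 1]. *)
  have : (d * 2 ^+ M = - (2 ^+ M - 1) ^+ 2)%R.
    by rewrite /d; field; rewrite expf_neq0.
  by apply: contra_eq_neq => ->; rewrite mul0r; nra.
move=> i j /(congr1 (fun g => (aff g (0, 0)%R).2)); rewrite !powE /=.
exact: (mulrIn d0).
Qed.

End Group.

(** * Action on the factors and the infinite stabiliser *)

Section FactorAction.
Variables (k : nat) (T : 'I_k -> tree) (rho : {multiplicative G -> aut_prod T}).
Variable i : 'I_k.

Definition factor_action (g : G) : aut (T i) := rho g i.

Fact factor_action_morph : {morph factor_action : g h / (g / h)%g}.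
Proof.
move=> g h; rewrite /factor_action.
have rV : rho h^-1%g = (rho h)^-1%g.
  apply/esym/mulg1_eq; rewrite -gmulfM mulgV.
  by apply: (mulgI (rho 1%g)); rewrite -gmulfM mulg1 mulg1.
by rewrite gmulfM rV.
Qed.

HB.instance Definition _ :=
  isGroupMorphism.Build G (aut (T i)) factor_action factor_action_morph.

End FactorAction.

Theorem theorem6p4 (k : nat) (T : 'I_k -> tree)
    (T_lf : forall i, locally_finite (T i))
    (rho : {multiplicative G -> aut_prod T}) :
  ~ proper_action rho.
Proof.
(* A sigma type, so that the exponents and vertices become functions of [i]. *)
have fixed_at i : {Nv : nat * T i | 0 < Nv.1 /\ forall M, Nv.1 %| M ->
    factor_action rho i (comm_b M) Nv.2 = Nv.2}.
  apply: cid; have [||N N0 [v vP]] := @conj_powers_commute _ (factor_action rho i Ga)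
    (factor_action rho i Gb) (factor_action rho i Gt) (T_lf i).
  - by rewrite -!gmulfM G_relta.
  - by rewrite -!gmulfM G_reltb.
  exists (N, v); split=> //= M /vP; rewrite /comm_b gmulfR gmulfJ gmulfXn => e.
  exact: commg_fix.
(* A common multiple of the exponents of all factors; it is 1 when [k = 0]. *)
pose M := (\prod_i (sval (fixed_at i)).1)%N.
have M0 : 0 < M by rewrite prodn_gt0 // => i; case: (svalP (fixed_at i)).
pose v : prod_vertex T := fun i => (sval (fixed_at i)).2.
(* Pulled back along the injective map [j -> comm_b M ^+ j], a finite stabiliser of [v] would give a
   finite set of naturals, but every [j] lies in it. *)
move=> /(_ v) /(finite_preimage (in2W (comm_b_pow_inj M0))).
set A := (_ @^-1` _)%classic; suff -> : A = setT by move=> /infinite_nat.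
rewrite -subTset => j _; apply: functional_extensionality_dep => i.
rewrite /prod_act -/(factor_action rho i _) gmulfXn; apply: autX_fix.
by have [_] := svalP (fixed_at i); apply; rewrite /M (bigD1 i) //= dvdn_mulr.
Qed.
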